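(* For integers $r\ge 0$ and $n\ge 0$ let $h_r(n)$ denote the number of permutations in $S_n$ that avoid the generalized pattern $21\text{-}3$ and contain exactly $r$ occurrences of the generalized pattern $12\text{-}3$, and put $h_r(n)=0$ for $n<0$. Then for all $n\ge 1$, $$h_0(n)=h_0(n-1)+(n-1)h_0(n-2),$$ $$h_1(n)=h_1(n-1)+(n-1)h_1(n-2)+(n-2)h_0(n-3),$$ $$h_2(n)=h_2(n-1)+(n-1)h_2(n-2)+(n-2)h_1(n-3)+(n-3)h_0(n-3).$$
   Context: $S_n$ is the set of permutations $\pi=\pi_1\pi_2\cdots\pi_n$ of $\{1,\dots,n\}$; $S_0$ consists of the empty permutation only. An occurrence of a generalized pattern $ab\text{-}c$ (with $abc$ a permutation of $\{1,2,3\}$) in $\pi$ is a pair $(i,j)$ with $i+1<j\le n$ such that $(\pi_i,\pi_{i+1},\pi_j)$ is order-isomorphic to $(a,b,c)$ (so the first two letters are adjacent in $\pi$). $\pi$ avoids the pattern if it has no occurrence of it. *)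

(* Defs.v *)
From mathcomp Require Import all_boot all_order all_fingroup all_algebra.

Set Implicit Arguments.
Unset Strict Implicit.
Unset Printing Implicit Defensive.

Local Open Scope nat_scope.

Definition order_isomorphic (k : nat) (u v : k.-tuple nat) : bool :=
  [forall i : 'I_k, forall j : 'I_k,
     (tnth u i < tnth u j) == (tnth v i < tnth v j)].

(* A permutation in 'S_n acts on {0, ..., n-1} instead of {1, ..., n}; both
   positions and values are shifted by one, which affects neither adjacency
   nor relative order.
   [abc] encodes the generalized pattern ab-c. The witness [i'] is the position
   following [ij.1], so that occurrences are counted as pairs (i, j). *)
Definition occurrences (n : nat) (abc : 3.-tuple nat) (s : 'S_n) :
    {set 'I_n * 'I_n} :=
  [set ij : 'I_n * 'I_n | (ij.1.+1 < ij.2) &&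
     [exists i' : 'I_n, (i' == ij.1.+1 :> nat) &&
        order_isomorphic [tuple s ij.1 : nat; s i' : nat; s ij.2 : nat] abc]].

Definition pat_12_3 : 3.-tuple nat := [tuple 1; 2; 3].
Definition pat_21_3 : 3.-tuple nat := [tuple 2; 1; 3].

Definition avoids (n : nat) (abc : 3.-tuple nat) (s : 'S_n) : bool :=
  occurrences abc s == set0.

Definition h (r : nat) (n : int) : int :=
  match n with
  | Posz m =>
      Posz #|[set s : 'S_m | avoids pat_21_3 s &
                             #|occurrences pat_12_3 s| == r]|
  | Negz _ => 0%R
  end.

(* Main.v *)
(* A permutation avoiding 21-3 is A m T with m its maximum, A increasing and T
   again avoiding 21-3: a descent before m would form a 21-3 with m. Every letter
   of A but the first ends an ascent, which contributes one occurrence of 12-3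
   for each larger letter of the permutation, and the ascent to m contributes
   none. Two such letters already give 1 + 2 = 3 occurrences, so with at most two
   occurrences A is empty, or a single letter, or two letters x < b where b is
   the second or third largest letter of the permutation. *)
Require Import Defs.
From mathcomp Require Import all_boot all_order all_fingroup all_algebra.
From mathcomp Require Import zify.

Local Open Scope nat_scope.

(** * Permutations as words *)

Fixpoint occ (R : nat -> nat -> pred nat) (w : seq nat) : nat :=
  if w is a :: t then (if t is b :: u then count (R a b) u else 0) + occ R t
  else 0.

(** The double index ranges over the same pairs as [occurrences]. The default 0 of [nth] never
    matters, since [i.+1 < j] keeps all three positions in range. *)
Lemma occ_sum (R : nat -> nat -> pred nat) (w : seq nat) :
  occ R w = \sum_(i < size w) \sum_(j < size w)
    ((i.+1 < j) && R (nth 0 w i) (nth 0 w i.+1) (nth 0 w j)).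
Proof.
elim: w => [|a t IHt]; first by rewrite big_ord0.
rewrite [occ _ _]/= IHt big_ord_recl; congr (_ + _); last first.
  by apply: eq_bigr => i _; rewrite big_ord_recl add0n; apply: eq_bigr.
case: t {IHt} => [|b u]; first by rewrite big_ord_recl big_ord0.
rewrite !big_ord_recl !add0n -sumn_count sumnE big_map.
by rewrite (big_nth 0) big_mkord; apply: eq_bigr.
Qed.

Definition word (n : nat) (s : 'S_n) : seq nat :=
  [seq val (s i) | i <- enum 'I_n].

Lemma size_word (n : nat) (s : 'S_n) : size (word n s) = n.
Proof. by rewrite size_map size_enum_ord. Qed.

Lemma nth_word (n : nat) (s : 'S_n) (i : 'I_n) : nth 0 (word n s) i = s i.
Proof. by rewrite (nth_map i) ?size_enum_ord // nth_ord_enum. Qed.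

Lemma word_inj (n : nat) : injective (word n).
Proof.
move=> s t eq_st; apply/permP => i; apply: val_inj.
by rewrite /= -!nth_word eq_st.
Qed.

(** [word] is injective with values among the rearrangements of [iota 0 n]; as there are n! of each,
    it reaches all of them. *)
Lemma perm_words (n : nat) :
  perm_eq [seq word n s | s : 'S_n] (permutations (iota 0 n)).
Proof.
have uniqW : uniq [seq word n s | s : 'S_n].
  by rewrite map_inj_uniq ?enum_uniq //; apply: word_inj.
apply: uniq_perm => //; first exact: permutations_uniq.
apply: (uniq_min_size uniqW _ _).2 => [_ /imageP[s _ ->]|].
  rewrite mem_permutations uniq_perm ?iota_uniq //.
    by rewrite map_inj_uniq ?enum_uniq // => i j /val_inj /perm_inj.
  move=> k; rewrite mem_iota add0n leq0n.
  apply/mapP/idP => [[i _ ->]|ltkn]; first exact: ltn_ord.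
  by exists ((s^-1)%g (Ordinal ltkn)); rewrite ?mem_enum // permKV.
by rewrite size_image card_Sn size_permutations ?iota_uniq // size_iota.
Qed.

Lemma card_occurrences (n : nat) (abc : 3.-tuple nat) (s : 'S_n) :
  #|@occurrences n abc s| =
  occ (fun a b c => order_isomorphic [tuple a; b; c] abc) (word n s).
Proof.
rewrite occ_sum size_word -sum1dep_card pair_big /= big_mkcond.
apply: eq_bigr => -[i j] _ /=; case: ltnP => //= ltij.
have lti : i.+1 < n by apply: ltn_trans (ltn_ord j).
rewrite !nth_word (nth_word n s (Ordinal lti)).
(* The existential witness is forced to be the position [i.+1], an ordinal because
   [i.+1 < j < n]. *)
case: existsP => [[k /andP[/eqP eq_ki iso]]|no].
  by rewrite -(_ : k = Ordinal lti) ?iso //; apply: val_inj.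
case iso: (order_isomorphic _ _) => //; case: no; exists (Ordinal lti); rewrite iso.
by rewrite eqxx.
Qed.

Definition incr a b : pred nat := fun c => a < b < c.
Definition decr a b : pred nat := fun c => b < a < c.

Lemma order_isomorphic3 a b c (abc : 3.-tuple nat) :
  order_isomorphic [tuple a; b; c] abc =
  let x := nth 0 abc in
  [&& (a < b) == (x 0 < x 1), (b < a) == (x 1 < x 0), (a < c) == (x 0 < x 2),
      (c < a) == (x 2 < x 0), (b < c) == (x 1 < x 2) & (c < b) == (x 2 < x 1)].
Proof.
apply/forallP/andP => [iso | [? /and5P[? ? ? ? ?]] i].
  have {}iso i j (lti : i < 3) (ltj : j < 3) :
      (nth 0 [:: a; b; c] i < nth 0 [:: a; b; c] j) ==
      (nth 0 abc i < nth 0 abc j).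
    by move/forallP/(_ (Ordinal ltj)): (iso (Ordinal lti)); rewrite !(tnth_nth 0).
  split; [exact: (iso 0 1) | apply/and5P; split].
  - exact: (iso 1 0).
  - exact: (iso 0 2).
  - exact: (iso 2 0).
  - exact: (iso 1 2).
  - exact: (iso 2 1).
apply/forallP => j; rewrite !(tnth_nth 0).
by case: i j => [[|[|[|i]]] ?] [[|[|[|j]]] ?] //=; rewrite !ltnn.
Qed.

Lemma iso_12_3 a b c : order_isomorphic [tuple a; b; c] pat_12_3 = incr a b c.
Proof. rewrite order_isomorphic3 /incr /=; lia. Qed.

Lemma iso_21_3 a b c : order_isomorphic [tuple a; b; c] pat_21_3 = decr a b c.
Proof. rewrite order_isomorphic3 /decr /=; lia. Qed.

Lemma eq_occ (R R' : nat -> nat -> pred nat) (w : seq nat) :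
  (forall a b, R a b =1 R' a b) -> occ R w = occ R' w.
Proof.
move=> eqR; elim: w => //= a t ->; congr (_ + _).
by case: t => // b u; apply: eq_count.
Qed.

(** * Counting words over an arbitrary alphabet *)

Definition good (r : nat) (w : seq nat) : bool :=
  (occ decr w == 0) && (occ incr w == r).

(** The alphabet is any list, because the recursion below deletes letters from it. *)
Definition num_good (r : nat) (s : seq nat) : nat :=
  count (good r) (permutations s).

Lemma h_num_good (r n : nat) : h r n = num_good r (iota 0 n).
Proof.
rewrite /h /num_good -(seq.permP (perm_words n)) count_map; congr Posz.
rewrite -sum1dep_card -sum1_count big_enum_cond.
apply: eq_bigl => s; rewrite /good /avoids -cards_eq0 !card_occurrences.
by rewrite (eq_occ _ _ _ iso_12_3) (eq_occ _ _ _ iso_21_3).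
Qed.

Lemma num_good_perm (r : nat) (s t : seq nat) :
  perm_eq s t -> num_good r s = num_good r t.
Proof. by move=> /perm_permutations/seq.permP; apply. Qed.

Lemma count_permutations (Q : pred (seq nat)) (s : seq nat) :
  uniq s -> 0 < size s ->
  count Q (permutations s) =
    \sum_(x <- s) count (fun t => Q (x :: t)) (permutations (rem x s)).
Proof.
move=> uniq_s /permutationsE/seq.permP->; rewrite undup_id //.
rewrite -sumn_count sumnE big_map big_allpairs_dep.
by apply: eq_bigr => x _; rewrite -sumn_count sumnE big_map.
Qed.

(** * Effect of the first letters of a word *)

Lemma count_none (T : eqType) (P : pred T) (w : seq T) :
  {in w, forall c, P c = false} -> count P w = 0.
Proof. by move=> noP; rewrite (eq_in_count noP) count_pred0. Qed.

Lemma occ_cons_none (R : nat -> nat -> pred nat) (a b : nat) (u : seq nat) :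
  {in u, forall c, R a b c = false} -> occ R [:: a, b & u] = occ R (b :: u).
Proof. by move=> noR; rewrite [LHS]/= count_none. Qed.

(** The third letter of either pattern exceeds both adjacent ones, so an adjacent pair containing
    the maximum starts no occurrence. The next lemma rests on the same fact. *)
Lemma good_max (r m : nat) (w : seq nat) :
  all (gtn m) w -> good r (m :: w) = good r w.
Proof.
case: w => // b u /= /andP[ltbm /allP ltum].
by rewrite /good !occ_cons_none // => c /ltum /=; rewrite /incr /decr; lia.
Qed.

Lemma good_before_max (r m x : nat) (w : seq nat) :
  x < m -> all (gtn m) w -> good r [:: x, m & w] = good r w.
Proof.
move=> ltxm ltwm; rewrite -(good_max r m w ltwm) /good.
by rewrite !occ_cons_none // => c /(allP ltwm) /=; rewrite /incr /decr; lia.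
Qed.

(** Each later letter above [b] completes the ascent to a 12-3, and none completes it to a 21-3. The
    bound [<= r] guards the truncated subtraction. *)
Lemma good_ascent (r x b : nat) (u : seq nat) : x < b ->
  good r [:: x, b & u] =
  (count (ltn b) u <= r) && good (r - count (ltn b) u) (b :: u).
Proof.
move=> ltxb; have ->: good r [:: x, b & u] = (occ decr (b :: u) == 0)
    && (count (ltn b) u + occ incr (b :: u) == r).
  rewrite /good [occ decr (x :: _)]/= [occ incr (x :: _)]/=.
  rewrite (eq_count (_ : decr x b =1 pred0)) ?count_pred0; last first.
    by move=> c; rewrite /decr /= ltnNge ltnW.
  by rewrite (eq_count (_ : incr x b =1 ltn b)) // => c; rewrite /incr ltxb.
by rewrite /good; case: (_ == 0) => //=; rewrite ?andbF //; lia.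
Qed.

Lemma good_descent (r m x b : nat) (u : seq nat) :
  b < x < m -> m \in u -> good r [:: x, b & u] = false.
Proof.
move=> /andP[ltbx ltxm] mu.
have: has (decr x b) u by apply/hasP; exists m; rewrite // /decr ltbx.
by rewrite has_count /good /=; lia.
Qed.

Lemma good_head_lt_max (r m x b : nat) (u : seq nat) :
  x < m -> x != b -> m \in u -> good r [:: x, b & u] -> x < b.
Proof.
move=> ltxm neq mu g; rewrite ltnNge leq_eqVlt eq_sym (negbTE neq) /=.
by apply: contraTN g => ltbx; rewrite (good_descent _ m) ?ltbx.
Qed.

(** With [m] still to come, [x < b < c] is forced. Then [c] and [m] complete the ascent into [b],
    and [m] completes the one into [c]: three occurrences, more than [r]. *)
Lemma good_two_ascents (r m x b c : nat) (v : seq nat) :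
  r < 3 -> x < b < m -> c < m -> b != c -> m \in v ->
  good r [:: x, b, c & v] = false.
Proof.
move=> ltr3 /andP[ltxb ltbm] ltcm neqbc mv; apply/negP.
rewrite good_ascent // => /andP[le_r gb].
have ltbc : b < c by apply: (good_head_lt_max _ m) gb.
move: gb le_r; rewrite good_ascent // => /andP[le_r' _] /=.
have cnt a : a < m -> 0 < count (ltn a) v.
  by move=> ltam; rewrite -has_count; apply/hasP; exists m.
by move: (cnt _ ltbm) (cnt _ ltcm) le_r'; rewrite /= ltbc; lia.
Qed.

(** * Recursion on the position of the maximum *)

Lemma num_good_ascent (r m x b : nat) (q : seq nat) :
  r < 3 -> x < b -> uniq (m :: b :: q) -> all (gtn m) (x :: b :: q) ->
  count (fun u => good r [:: x, b & u]) (permutations (m :: q)) =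
  if count (ltn b) q < r then num_good (r - (count (ltn b) q).+1) q else 0.
Proof.
move=> ltr3 ltxb /= /and3P[] mNbq bNq uniq_q /and3P[ltxm ltbm ltqm].
have mNq : m \notin q by apply: contra mNbq; rewrite inE orbC => ->.
rewrite count_permutations //= ?mNq // big_cons eqxx.
(* A third letter other than [m] would give two ascents before the maximum. *)
rewrite big_seq big1 ?addn0 => [|c cq]; last first.
  have /= ltcm := allP ltqm _ cq.
  apply: count_none => v; rewrite gtn_eqF // mem_permutations => /perm_mem/(_ m);
  rewrite mem_head => mv.
  rewrite (good_two_ascents r m) ?ltxb //.
  by apply: contraNneq bNq => ->.
(* The ascent into [b] uses up [k.+1] occurrences: one for each letter of [q] above [b], and one for
   [m]. *)
set k := count (ltn b) q; set r' := r - k.+1.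
rewrite (eq_in_count (a2 := fun v => (k < r) && good r' v)) => [|v].
  by case: (k < r) => //; apply: count_pred0.
rewrite mem_permutations => pvq; rewrite good_ascent //= ltbm.
rewrite (seq.permP pvq) add1n good_before_max //.
by rewrite (eq_all_r (perm_mem pvq)).
Qed.

(** The three terms come from the maximum in first, second and third place, after nothing, after
    [x], and after [x < b]. *)
Lemma num_good_rec (r m : nat) (s : seq nat) :
  r < 3 -> uniq s -> all (gtn m) s ->
  num_good r (m :: s) = num_good r s + \sum_(x <- s) (num_good r (rem x s) +
    \sum_(b <- s | x < b) if count (ltn b) s < r
      then num_good (r - (count (ltn b) s).+1) (rem b (rem x s)) else 0).
Proof.
move=> ltr3 uniq_s ltsm; have mNs : m \notin s.
  by apply/negP => /(allP ltsm); rewrite /= ltnn.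
have ltrem x : all (gtn m) (rem x s).
  by apply/allP => y /mem_rem/(allP ltsm).
rewrite {1}/num_good count_permutations //= ?mNs // big_cons eqxx.
congr (_ + _).
  apply: eq_in_count => t; rewrite mem_permutations => pts.
  by rewrite good_max // (eq_all_r (perm_mem pts)).
rewrite !(@big_seq _ _ _ _ s); apply: eq_bigr => x xs.
have neq_mx : (m == x) = false by apply: contraNF mNs => /eqP->.
have /= ltxm := allP ltsm _ xs.
have mNr : m \notin rem x s by apply: contra mNs; apply: mem_rem.
rewrite neq_mx count_permutations //= ?mNr ?rem_uniq //= big_cons eqxx.
congr (_ + _).
  apply: eq_in_count => t; rewrite mem_permutations => pts.
  by rewrite good_before_max // (eq_all_r (perm_mem pts)).
rewrite (big_rem x xs) /= ltnn add0n [RHS]big_mkcond.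
rewrite !(@big_seq _ _ _ _ (rem x s)); apply: eq_bigr => b bs.
have /= ltbm := allP (ltrem x) _ bs.
rewrite (gtn_eqF ltbm).
have ps : perm_eq s [:: x, b & rem b (rem x s)].
  by apply: perm_trans (perm_to_rem xs) _; rewrite perm_cons perm_to_rem.
have uniq_xb : uniq [:: x, b & rem b (rem x s)] by rewrite -(perm_uniq ps).
case: ltnP => [ltxb|lebx]; last first.
  apply: count_none => u; rewrite mem_permutations => /perm_mem/(_ m);
  rewrite mem_head => mu.
  rewrite (good_descent r m) // ltxm andbT ltn_neqAle lebx andbT.
  by move: uniq_xb => /= /andP[]; rewrite inE eq_sym negb_or => /andP[].
rewrite num_good_ascent //.
(* Neither [x] nor [b] lies above [b], so counting in [s] or in what remains of it gives the same
   number. *)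
- by rewrite (seq.permP ps) /= ltnn (leq_gtF (ltnW ltxb)).
- move: uniq_xb => /= /andP[_ ->]; rewrite andbT inE negb_or (gtn_eqF ltbm) /=.
  by apply: contra mNr; apply: mem_rem.
by rewrite -(eq_all_r (perm_mem ps)).
Qed.

(** A decreasing alphabet stays decreasing under deletion and has its largest letters at the front.
    [F] stands for the claim that only the length matters, so that the lemma serves both inside the
    induction proving this claim and after it. *)
Lemma num_good_sorted_rec (F : nat -> nat -> nat) (r m : nat) (s : seq nat) :
  r < 3 -> sorted gtn (m :: s) ->
  (forall q t, t < 3 -> sorted gtn q -> size q <= size s ->
     num_good t q = F t (size q)) ->
  num_good r (m :: s) = F r (size s) + size s * F r (size s).-1
    + (if 0 < r then (size s).-1 * F r.-1 (size s).-2 else 0)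
    + (if 1 < r then (size s).-2 * F r.-2 (size s).-2 else 0).
Proof.
have gtn_trans : transitive gtn by move=> a b c /= lt1 lt2; apply: ltn_trans lt1.
move=> ltr3 sorted_ms IH; have sorted_s := path_sorted sorted_ms.
have ltsm := order_path_min gtn_trans sorted_ms.
have uniq_s : uniq s.
  by apply: (sorted_uniq gtn_trans) sorted_s => a /=; apply: ltnn.
have remF x q t : t < 3 -> sorted gtn q -> x \in q -> size q <= size s ->
    num_good t (rem x q) = F t (size q).-1.
  move=> ltt sq xq leq; rewrite -(size_rem xq); apply: IH => //.
    exact: subseq_sorted (rem_subseq x q) sq.
  by rewrite size_rem // (leq_trans (leq_pred _)).
rewrite num_good_rec // IH // -!addnA; congr (_ + _).
rewrite big_split /=; congr (_ + _).
  rewrite big_seq (eq_bigr (fun=> F r (size s).-1)) => [|x xs].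
    by rewrite -big_seq big_const_seq iter_addn_0 count_predT mulnC.
  exact: remF.
pose f b := if count (ltn b) s < r
  then F (r - (count (ltn b) s).+1) (size s).-2 else 0.
(* The pairs [x < b] are grouped by [b], whose summand [f b] does not depend on [x]. *)
transitivity (\sum_(b <- s) count (gtn b) s * f b).
  transitivity (\sum_(x <- s) \sum_(b <- s | x < b) f b).
    rewrite !(@big_seq _ _ _ _ s); apply: eq_bigr => x xs.
    rewrite big_seq_cond [RHS]big_seq_cond; apply: eq_bigr => b /andP[bs ltxb].
    rewrite /f; case: ifP => // _.
    have bx : b \in rem x s by rewrite mem_rem_uniq // !inE bs andbT gtn_eqF.
    rewrite -(size_rem xs); apply: remF => //; first by lia.
      exact: subseq_sorted (rem_subseq x s) sorted_s.
    by rewrite size_rem // leq_pred.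
  rewrite (exchange_big_dep predT) //=; apply: eq_bigr => b _.
  by rewrite big_const_seq iter_addn_0 mulnC.
rewrite /f.
case: s sorted_s {sorted_ms IH ltsm uniq_s remF f} => [|b0 [|b1 s]] sorted_s.
(* With fewer than two letters there is no pair [x < b], and the truncated factors [(size s).-1] and
   [(size s).-2] are 0. *)
- by rewrite big_nil; case: (0 < r); case: (1 < r).
- by rewrite big_cons big_nil /= ltnn; case: (0 < r); case: (1 < r).
have [/= lt10 path1] := andP sorted_s; have lt1 := order_path_min gtn_trans path1.
have lt0 : all (gtn b0) s by apply: sub_all lt1 => a /= lta; apply: ltn_trans lt10.
have cnt a : all (gtn a) s -> (count (gtn a) s = size s) * (count (ltn a) s = 0).
  move=> lta; split; first by apply/eqP; rewrite -all_count.
  by apply: count_none => c /(allP lta) /= /ltnW/leq_gtF.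
(* Any [b] after the first two letters has both of them above it, so [count (ltn b) s < r] fails for
   [r < 3]. Only [b0] and [b1] remain, with counts 0 and 1. *)
rewrite !big_cons big_seq big1 => [|b bs]; last first.
  have := allP lt0 _ bs; have := allP lt1 _ bs => /= -> ->.
  by rewrite ifF ?muln0 //; lia.
rewrite addn0 /= !cnt // !ltnn lt10 (leq_gtF (ltnW lt10)) !(addn0, add0n, add1n).
by case: r ltr3 => [|[|[|r]]] //= _; rewrite ?muln0 ?addn0.
Qed.

(** * The recurrence in the number of letters *)

Lemma sorted_rev_iota (n : nat) : sorted gtn (rev (iota 0 n)).
Proof. by rewrite rev_sorted; apply: iota_ltn_sorted. Qed.

Lemma num_good_rev_iota (r n : nat) :
  num_good r (rev (iota 0 n)) = num_good r (iota 0 n).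
Proof. by apply: num_good_perm; rewrite perm_rev. Qed.

(** Strong induction on the length: the recursion has the same right-hand side for [m :: s] and for
    the decreasing list of the same length. *)
Lemma num_good_sorted (r : nat) (s : seq nat) :
  r < 3 -> sorted gtn s -> num_good r s = num_good r (iota 0 (size s)).
Proof.
have [n] := ubnP (size s); elim: n r s => // n IHn r [|m s] // ltsn ltr3 sorted_ms.
have IH q t : t < 3 -> sorted gtn q -> size q <= size s ->
    num_good t q = num_good t (iota 0 (size q)).
  by move=> ltt sq leq; apply: IHn => //; apply: leq_ltn_trans leq _.
pose F t k := num_good t (iota 0 k).
rewrite (num_good_sorted_rec F) // -num_good_rev_iota.
move: (sorted_rev_iota (size s).+1).
(* Brings the maximum [size s] of the reversed [iota] to its head. *)
rewrite [size (_ :: _)]/= -addn1 iotaD rev_cat /= => sorted_iota.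
by rewrite (num_good_sorted_rec F) ?size_rev ?size_iota.
Qed.

Lemma h_rec (r n : nat) : r < 3 ->
  h r n.+1 = (h r n + n%:Z * h r n.-1
    + (if (0 < r)%N then n.-1%:Z * h r.-1 n.-2 else 0)
    + (if (1 < r)%N then n.-2%:Z * h r.-2 n.-2 else 0))%R.
Proof.
move=> ltr3; rewrite !h_num_good -num_good_rev_iota.
move: (sorted_rev_iota n.+1).
rewrite -addn1 iotaD rev_cat /= => sorted_iota.
rewrite (num_good_sorted_rec (fun t k => num_good t (iota 0 k))) //.
  rewrite size_rev size_iota !PoszD PoszM.
  by case: (0 < r); case: (1 < r); rewrite -?PoszM.
by move=> q t ltt sq _; apply: num_good_sorted.
Qed.

Local Open Scope ring_scope.

Theorem theorem4p5 (n : int) (hn : 1 <= n) :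
  [/\ h 0 n = h 0 (n - 1) + (n - 1) * h 0 (n - 2),
      h 1 n = h 1 (n - 1) + (n - 1) * h 1 (n - 2) + (n - 2) * h 0 (n - 3) &
      h 2 n = h 2 (n - 1) + (n - 1) * h 2 (n - 2) + (n - 2) * h 1 (n - 3)
              + (n - 3) * h 0 (n - 3)].
Proof.
case: n hn => [[|[|[|n]]]|] // _.
(* For arguments 1 and 2, each negative coefficient multiplies a value of [h] at a negative
   argument, which is 0. From 3 on, no predecessor in [h_rec] is truncated. *)
- by rewrite !h_rec //= !(GRing.mul0r, GRing.mulr0, GRing.addr0).
- by rewrite !(h_rec _ 1) //= !(GRing.mul0r, GRing.mulr0, GRing.addr0).
have -> : n.+3%:Z - 1 = n.+2 by lia.
have -> : n.+3%:Z - 2 = n.+1 by lia.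
have -> : n.+3%:Z - 3 = n by lia.
by rewrite !(h_rec _ n.+2) //= !GRing.addr0.
Qed.
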